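(* Let $R$ be a ring with identity and let $U$ be a right $R$-module that is both uniform and hollow. Put $M = U^2 = U \times U$, $U_1 = U \times 0$ and $U_2 = 0 \times U$ (submodules of $M$). Then the following conditions are equivalent: (a) $M$ is extending; (b) for any right $R$-module $X$, any homomorphism $f : X \to U_2$ and any monomorphism $g : X \to U_1$, one of the following holds: (i) there exists a homomorphism $h : U_1 \to U_2$ such that $f = hg$; (ii) there exist a submodule $K$ of $U_1$ and a monomorphism $h : U_2 \to U_1/K$ such that $hf = \pi g$, where $\pi$ is the natural epimorphism from $U_1$ to $U_1/K$; (c) for any right $R$-module $X$, any homomorphism $f : X \to U_2$ and any monomorphism $g : X \to U_1$, one of the following holds: (i) there exists a homomorphism $h : U_1 \to U_2$ such that $f = hg$; (ii) there exist a submodule $N$ of $U_1$ containing $\operatorname{Im} g$ and an epimorphism $h : N \to U_2$ such that $f = hg$.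
   Context: All modules are unitary right modules over a ring $R$ with identity. A submodule $N$ of a module $M$ is small in $M$ if $N + X \neq M$ for every proper submodule $X$ of $M$. A module $M$ is extending if for any submodule $N$ of $M$ there exists a direct summand $X$ of $M$ such that $N$ is an essential submodule of $X$. A module $M$ is lifting if for any submodule $N$ of $M$ there exists a direct summand $X$ of $M$ with $X \subseteq N$ such that $N/X$ is small in $M/X$. A uniform module is an indecomposable (in particular nonzero) extending module; equivalently, a nonzero module all of whose nonzero submodules are essential. A hollow module is an indecomposable (in particular nonzero) lifting module; equivalently, a nonzero module all of whose proper submodules are small. Composition is written so that $hg$ means first $g$, then $h$. *)

(* Defs.v *)
From HB Require Import structures.
From mathcomp Require Import all_boot all_algebra boolp.

Set Implicit Arguments.
Unset Strict Implicit.
Unset Printing Implicit Defensive.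

Import GRing.Theory.

Local Open Scope ring_scope.
Local Open Scope quotient_scope.

(* Submodules are Boolean predicates closed under the module operations        *)
(* ([submodClosed]). Reasoning is classical (boolp), so via [`[< _ >]] these   *)
(* are all the submodules. A right R-module is an [lmodType R^c], where R^c is *)
(* the opposite ring: the right action x.a is written a *: x.                  *)

Section Submodule.

Variables (R : pzRingType) (M : lmodType R) (N : submodClosed M).

Record submod : Type := Submod { submod_val : M; submod_valP : submod_val \in N }.

HB.instance Definition _ := [isSub for submod_val].
HB.instance Definition _ := [Choice of submod by <:].
HB.instance Definition _ := [SubChoice_isSubLmodule of submod by <:].

End Submodule.

Section Quotient.

Variables (R : pzRingType) (M : lmodType R) (K : submodClosed M).

(* MathComp does not derive [zmodClosed], which [Quotient.quot] needs, from    *)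
(* [submodClosed]; this copy of K carries both structures.                     *)
Definition zsubmod : {pred M} := fun x => x \in K.

Fact zsubmod_closed : subsemimod_closed zsubmod.
Proof.
split; first by split=> [|u v]; [exact: rpred0 | exact: rpredD].
by move=> a u; exact: rpredZ.
Qed.

HB.instance Definition _ := GRing.isSubmodClosed.Build R M zsubmod zsubmod_closed.

Definition quotmod : Type := Quotient.quot zsubmod.

HB.instance Definition _ := GRing.Zmodule.on quotmod.

Definition quotmod_pi (x : M) : quotmod := \pi_(Quotient.quot zsubmod) x.

Fact quotmod_piP (x y : M) : quotmod_pi x = quotmod_pi y <-> x - y \in K.
Proof.
rewrite -[x - y \in K]/(x - y \in zsubmod) Quotient.idealrBE.
by split=> [/eqP|/eqP].
Qed.

Fact quotmod_reprK : cancel (fun q : quotmod => repr q : M) quotmod_pi.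
Proof. by move=> q; rewrite /quotmod_pi reprK. Qed.

Fact quotmod_pi_zmod : zmod_morphism quotmod_pi.
Proof. by move=> x y; rewrite /quotmod_pi raddfB. Qed.

HB.instance Definition _ :=
  GRing.isZmodMorphism.Build M quotmod quotmod_pi quotmod_pi_zmod.

Definition quotmod_scale (a : R) (q : quotmod) : quotmod :=
  quotmod_pi (a *: (repr q : M)).

Fact quotmod_scale_pi a x : quotmod_scale a (quotmod_pi x) = quotmod_pi (a *: x).
Proof.
apply/quotmod_piP; rewrite -scalerBr; apply: rpredZ.
by apply/quotmod_piP; rewrite quotmod_reprK.
Qed.

Fact quotmod_scaleA a b q :
  quotmod_scale a (quotmod_scale b q) = quotmod_scale (a * b) q.
Proof. by rewrite -[q]quotmod_reprK !quotmod_scale_pi scalerA. Qed.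

Fact quotmod_scale1 : left_id 1 quotmod_scale.
Proof. by move=> q; rewrite -[q]quotmod_reprK quotmod_scale_pi scale1r. Qed.

Fact quotmod_scaleDr : right_distributive quotmod_scale +%R.
Proof.
move=> a p q; rewrite -[p]quotmod_reprK -[q]quotmod_reprK.
by rewrite -raddfD !quotmod_scale_pi scalerDr raddfD.
Qed.

Fact quotmod_scaleDl q : {morph quotmod_scale^~ q : a b / a + b}.
Proof.
by move=> a b; rewrite -[q]quotmod_reprK !quotmod_scale_pi scalerDl raddfD.
Qed.

HB.instance Definition _ := GRing.Zmodule_isLmodule.Build R quotmod
  quotmod_scaleA quotmod_scale1 quotmod_scaleDr quotmod_scaleDl.

Fact quotmod_pi_scalable : scalable quotmod_pi.
Proof. by move=> a x; rewrite -quotmod_scale_pi. Qed.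

HB.instance Definition _ :=
  GRing.isScalable.Build R M quotmod *:%R quotmod_pi quotmod_pi_scalable.

End Quotient.

Arguments quotmod_pi {R M} K x.

Section Image.

Variables (R : pzRingType) (M M' : lmodType R).
Variables (f : {linear M -> M'}) (N : submodClosed M).

Definition im_submod : {pred M'} := fun y => `[< exists2 x, x \in N & f x = y >].

Fact im_submod_closed : subsemimod_closed im_submod.
Proof.
split; first split=> [|u v].
- by apply/asboolP; exists 0; rewrite ?rpred0 ?linear0.
- move=> /asboolP[x Nx <-] /asboolP[y Ny <-]; apply/asboolP.
  by exists (x + y); rewrite ?rpredD ?linearD.
- move=> a u /asboolP[x Nx <-]; apply/asboolP.
  by exists (a *: x); rewrite ?rpredZ ?linearZ.
Qed.

HB.instance Definition _ :=
  GRing.isSubmodClosed.Build R M' im_submod im_submod_closed.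

End Image.

Section Modules.

Variables (R : pzRingType) (M : lmodType R).
Implicit Types (N X Y L : submodClosed M).

Definition sum_full N X : Prop :=
  forall m : M, exists n x, [/\ n \in N, x \in X & m = n + x].

Definition cap_trivial N X : Prop := forall m : M, m \in N -> m \in X -> m = 0.

Definition small N : Prop :=
  forall X, (exists m : M, m \notin X) -> ~ sum_full N X.

Definition direct_summand X : Prop :=
  exists Y, cap_trivial X Y /\ sum_full X Y.

Definition essential_in N X : Prop :=
  {subset N <= X} /\
  forall L, {subset L <= X} -> cap_trivial L N -> forall m, m \in L -> m = 0.

End Modules.

Definition extending (R : pzRingType) (M : lmodType R) : Prop :=
  forall N : submodClosed M,
    exists X : submodClosed M, direct_summand X /\ essential_in N X.

Definition lifting (R : pzRingType) (M : lmodType R) : Prop :=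
  forall N : submodClosed M, exists X : submodClosed M,
    [/\ direct_summand X, {subset X <= N} &
        small (im_submod (quotmod_pi X) N)].

Definition indecomposable (R : pzRingType) (M : lmodType R) : Prop :=
  (exists m : M, m != 0) /\
  forall X : submodClosed M, direct_summand X ->
    (forall m, m \in X -> m = 0) \/ (forall m, m \in X).

Definition uniform (R : pzRingType) (M : lmodType R) : Prop :=
  indecomposable M /\ extending M.

Definition hollow (R : pzRingType) (M : lmodType R) : Prop :=
  indecomposable M /\ lifting M.

Section Axes.

Variables (R : pzRingType) (U : lmodType R).

Definition axis1 : {pred U * U} := fun p => p.2 == 0.
Definition axis2 : {pred U * U} := fun p => p.1 == 0.

Fact axis1_closed : subsemimod_closed axis1.
Proof.
split; first split=> [|u v /eqP u0 /eqP v0]; first exact: eqxx.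
- by apply/eqP; rewrite /= u0 v0 addr0.
- by move=> a u /eqP u0; apply/eqP; rewrite /= u0 scaler0.
Qed.

Fact axis2_closed : subsemimod_closed axis2.
Proof.
split; first split=> [|u v /eqP u0 /eqP v0]; first exact: eqxx.
- by apply/eqP; rewrite /= u0 v0 addr0.
- by move=> a u /eqP u0; apply/eqP; rewrite /= u0 scaler0.
Qed.

HB.instance Definition _ :=
  GRing.isSubmodClosed.Build R (U * U)%type axis1 axis1_closed.
HB.instance Definition _ :=
  GRing.isSubmodClosed.Build R (U * U)%type axis2 axis2_closed.

End Axes.

Arguments axis1 {R} U _.
Arguments axis2 {R} U _.

(* Main.v *)
Require Import Defs.
From HB Require Import structures.
From mathcomp Require Import all_boot all_algebra boolp.

Set Implicit Arguments.
Unset Strict Implicit.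
Unset Printing Implicit Defensive.

Import GRing.Theory.

Local Open Scope ring_scope.

(* Conditions (b) and (c) both say that the partial map g x |-> f x extends to *)
(* a submodule D of U1 x U2 that is the graph of a map defined on all of U1 or *)
(* onto U2.                                                                    *)
(* If M is extending, take for D a direct summand in which the graph of f over *)
(* g is essential. Its complement D' cannot meet both axes (else D' would be   *)
(* essential and D = 0), so D' is itself a graph over one of the axes, and     *)
(* hollowness prevents both projections of D from being proper.                *)
(* Conversely, a submodule of M meeting both axes is essential in M; one that  *)
(* misses an axis is a graph, contained in a D as above, where it is essential *)
(* because D is isomorphic to a submodule of the uniform module U. Such a D is *)
(* a direct summand: a complement is one of the two axes or the diagonal.      *)

(** The question is moved to linear relations, that is, submodules D of A x B; a [functional] D is
    the graph of a partial map. Maps defined on all of A correspond to total D, and both the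
    monomorphisms of (b)(ii) and the epimorphisms of (c)(ii) correspond to onto D
    ([total_extensionP], [quotient_extensionP], [partial_extensionP]). Hence (b) and (c) agree
    alternative by alternative, and both amount to [graph_extension]. Uniformity acts through
    [uniform_cap] and hollowness through the dual [hollow_sum]. From (a) to [graph_extension] the
    work is done by [cap_axes_essential] and [complement_of_graph]; the converse rests on
    [graph_summand] and [graph_closure]. *)

Section Submodules.

Variables (R : pzRingType) (M M' : lmodType R).
Implicit Types (f : {linear M -> M'}) (N L : submodClosed M) (P : submodClosed M').

(** * Submodules attached to linear maps *)

Definition full_submod : {pred M} := fun=> true.

Fact full_submod_closed : subsemimod_closed full_submod.
Proof. by []. Qed.

HB.instance Definition _ :=
  GRing.isSubmodClosed.Build R M full_submod full_submod_closed.

Definition meet_submod N L : {pred M} := fun x => (x \in N) && (x \in L).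

Fact meet_submod_closed N L : subsemimod_closed (meet_submod N L).
Proof.
split; first split=> [|u v /andP[Nu Lu] /andP[Nv Lv]].
- by apply/andP; rewrite !rpred0.
- by apply/andP; rewrite !rpredD.
- by move=> a u /andP[Nu Lu]; apply/andP; rewrite !rpredZ.
Qed.

HB.instance Definition _ N L :=
  GRing.isSubmodClosed.Build R M (meet_submod N L) (meet_submod_closed N L).

Definition preim_submod f P : {pred M} :=
  fun x => f x \in P.

Fact preim_submod_closed f P : subsemimod_closed (preim_submod f P).
Proof.
split; first split=> [|u v Nu Nv].
- by rewrite unfold_in linear0 rpred0.
- by rewrite unfold_in linearD rpredD.
- by move=> a u Nu; rewrite unfold_in linearZ rpredZ.
Qed.

HB.instance Definition _ f P :=
  GRing.isSubmodClosed.Build R M (preim_submod f P) (preim_submod_closed f P).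

Definition ker_submod f : {pred M} := fun x => f x == 0.

Fact ker_submod_closed f : subsemimod_closed (ker_submod f).
Proof.
split; first split=> [|u v /eqP fu /eqP fv].
- by rewrite unfold_in linear0.
- by rewrite unfold_in linearD fu fv addr0.
- by move=> a u /eqP fu; rewrite unfold_in linearZ fu /= scaler0.
Qed.

HB.instance Definition _ f :=
  GRing.isSubmodClosed.Build R M (ker_submod f) (ker_submod_closed f).

Lemma submodB N : {in N &, forall x y, x - y \in N}.
Proof. by move=> x y Nx Ny; rewrite -scaleN1r rpredD ?rpredZ. Qed.

Lemma mem_meet N L x : (x \in meet_submod N L) = (x \in N) && (x \in L).
Proof. by []. Qed.

Lemma mem_preim f P x :
  (x \in preim_submod f P) = (f x \in P).
Proof. by []. Qed.

Lemma mem_kerP f x : reflect (f x = 0) (x \in ker_submod f).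
Proof. exact: eqP. Qed.

Lemma mem_imP f N y : reflect (exists2 x, x \in N & f x = y) (y \in im_submod f N).
Proof. exact: asboolP. Qed.

Lemma mem_im f N x : x \in N -> f x \in im_submod f N.
Proof. by move=> Nx; apply/mem_imP; exists x. Qed.

Lemma inj_on_linear f N :
  cap_trivial N (ker_submod f) -> {in N &, injective f}.
Proof.
move=> kerN x y Nx Ny fxy; apply/eqP; rewrite -subr_eq0; apply/eqP.
by apply: kerN; [exact: submodB | apply/mem_kerP; rewrite linearB fxy subrr].
Qed.

End Submodules.

Arguments full_submod {R} M _.

Section Pairing.

Variables (R : pzRingType) (X A B : lmodType R).
Variables (g : {linear X -> A}) (f : {linear X -> B}).

Definition pair_lin (x : X) : A * B := (g x, f x).

Fact pair_lin_linear : linear pair_lin.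
Proof. by move=> a x y; rewrite /pair_lin !linearP. Qed.

HB.instance Definition _ :=
  GRing.isLinear.Build R X (A * B)%type *:%R pair_lin pair_lin_linear.

End Pairing.

(** * Linear relations and the maps they define *)

Section LinearRelations.

Variables (R : pzRingType) (A B : lmodType R).
Implicit Types D : submodClosed (A * B)%type.

(** Single-valuedness: by additivity it is enough to test it over 0 ([functional_eq]). *)
Definition functional D := forall b, (0, b) \in D -> b = 0.
Definition total D := forall a, exists b, (a, b) \in D.
Definition onto D := forall b, exists a, (a, b) \in D.

Lemma functional_eq D a b b' :
  functional D -> (a, b) \in D -> (a, b') \in D -> b = b'.
Proof.
move=> Dfun Db Db'; apply/eqP; rewrite -subr_eq0; apply/eqP/Dfun.
have -> : (0, b - b') = (a, b) - (a, b') by congr pair; rewrite /= subrr.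
exact: submodB.
Qed.

Lemma functional_linear D : functional D -> total D ->
  exists h : {linear A -> B}, forall a, (a, h a) \in D.
Proof.
move=> Dfun /choice[h Dh].
have h_lin : linear h.
  move=> c x y; apply: (functional_eq Dfun (Dh _)).
  have -> : (c *: x + y, c *: h x + h y) = c *: (x, h x) + (y, h y) by [].
  by rewrite rpredD ?rpredZ.
pose H := GRing.isLinear.Build R A B *:%R h h_lin.
by exists (HB.pack_for {linear A -> B} h H).
Qed.

End LinearRelations.

(** * The alternatives of (b) and (c) as linear relations *)

Section Extensions.

Variables (R : pzRingType) (X A B : lmodType R).
Variables (f : {linear X -> B}) (g : {linear X -> A}).
Implicit Types D : submodClosed (A * B)%type.

Lemma total_extensionP :
  (exists h : {linear A -> B}, forall x, f x = h (g x)) <->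
  exists D, [/\ functional D, forall x, (g x, f x) \in D & total D].
Proof.
split=> [[h fE]|[D [Dfun Dgf /(functional_linear Dfun)[h Dh]]]]; last first.
  by exists h => x; apply: functional_eq Dfun (Dgf x) (Dh _).
pose D : submodClosed (A * B)%type :=
  im_submod (pair_lin idfun h) (full_submod A).
exists D; split.
- by move=> b /mem_imP[x _ [-> <-]]; rewrite linear0.
- by move=> x; apply/mem_imP; exists (g x); rewrite // fE.
- by move=> a; exists (h a); apply/mem_imP; exists a.
Qed.

(** A map h encodes the relation h b = a + K, functional because h is injective and onto because the
    projection is surjective. Conversely K collects the elements related to 0, and b goes to the
    class of any a related to it; functionality of D makes this map injective. *)
Lemma quotient_extensionP :
  (exists (K : submodClosed A) (h : {linear B -> quotmod K}),
     injective h /\ forall x, h (f x) = quotmod_pi K (g x)) <->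
  exists D, [/\ functional D, forall x, (g x, f x) \in D & onto D].
Proof.
split=> [[K [h [h_inj hf]]]|[D [Dfun Dgf Donto]]].
  pose D : submodClosed (A * B)%type :=
    ker_submod ((h \o snd) \- (quotmod_pi K \o fst)).
  exists D; split.
  - move=> b /mem_kerP /= /eqP; rewrite linear0 subr0 => /eqP hb.
    by apply: h_inj; rewrite hb linear0.
  - by move=> x; apply/mem_kerP; rewrite /= hf subrr.
  - move=> b; exists (repr (h b)); apply/mem_kerP.
    by rewrite /= quotmod_reprK subrr.
pose K : submodClosed A := preim_submod (pair_lin idfun \0) D.
pose E : submodClosed (B * quotmod K)%type :=
  im_submod (pair_lin snd (quotmod_pi K \o fst)) D.
have memE b q : (b, q) \in E ->
    exists2 a, (a, b) \in D & q = quotmod_pi K a.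
  by case/mem_imP=> [[a b'] Dab [<- <-]]; exists a.
have pi0 a : quotmod_pi K a = 0 <-> a \in K.
  by rewrite -[X in _ = X](linear0 (quotmod_pi K)) quotmod_piP subr0.
have Efun : functional E by move=> q /memE[a Da0 ->]; apply/pi0.
have Etot : total E.
  move=> b; have [a Dab] := Donto b; exists (quotmod_pi K a).
  by apply/mem_imP; exists (a, b).
have [h Eh] := functional_linear Efun Etot.
exists K, h; split=> [b b' hbb'|x]; last first.
  by apply: (functional_eq Efun (Eh _)); apply/mem_imP; exists (g x, f x).
apply/eqP; rewrite -subr_eq0; apply/eqP/Dfun.
have [a Dab] := memE _ _ (Eh (b - b')).
rewrite linearB hbb' subrr => /esym/pi0 Da0.
have -> : (0, b - b') = (a, b - b') - (a, 0) by congr pair; rewrite /= ?subrr ?subr0.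
exact: submodB.
Qed.

(** D is the graph of h, and N is recovered as the domain of D. *)
Lemma partial_extensionP :
  (exists (N : submodClosed A) (img : forall x, g x \in N)
          (h : {linear submod N -> B}),
     (forall y, exists n, h n = y) /\ forall x, f x = h (Submod (img x))) <->
  exists D, [/\ functional D, forall x, (g x, f x) \in D & onto D].
Proof.
split=> [[N [img [h [h_onto fE]]]]|[D [Dfun Dgf Donto]]].
  pose D : submodClosed (A * B)%type :=
    im_submod (pair_lin val h) (full_submod (submod N)).
  exists D; split.
  - move=> b /mem_imP[x _ [x0 <-]].
    by have -> : x = 0 by [exact: val_inj]; rewrite linear0.
  - by move=> x; apply/mem_imP; exists (Submod (img x)); rewrite // fE.
  - move=> b; have [n <-] := h_onto b; exists (val n).
    by apply/mem_imP; exists n.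
pose N : submodClosed A := im_submod fst D.
have img x : g x \in N by apply/mem_imP; exists (g x, f x).
pose E : submodClosed (submod N * B)%type :=
  preim_submod (pair_lin (val \o fst) snd) D.
have Efun : functional E by move=> b; exact: Dfun.
have Etot : total E.
  move=> n; have /mem_imP[[a b] Dab /= aE] := submod_valP n.
  by exists b; suff: (submod_val n, b) \in D by []; rewrite -aE.
have [h Eh] := functional_linear Efun Etot.
exists N, img, h; split=> [b|x]; last first.
  have Egf : (Submod (img x), f x) \in E := Dgf x.
  exact: functional_eq Efun Egf (Eh _).
have [a Dab] := Donto b.
have Na : a \in N by apply/mem_imP; exists (a, b).
have Eab : (Submod Na, b) \in E := Dab.
by exists (Submod Na); apply: functional_eq Efun (Eh _) Eab.
Qed.

End Extensions.

(** * The common form of (b) and (c), and its transport *)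

Definition graph_extends (R : pzRingType) (X A B : lmodType R)
    (f : {linear X -> B}) (g : {linear X -> A}) : Prop :=
  exists D : submodClosed (A * B)%type,
    [/\ functional D, forall x, (g x, f x) \in D & total D \/ onto D].

Lemma graph_extendsE (R : pzRingType) (X A B : lmodType R)
    (f : {linear X -> B}) (g : {linear X -> A}) :
  graph_extends f g <->
  (exists D : submodClosed (A * B)%type,
     [/\ functional D, forall x, (g x, f x) \in D & total D]) \/
  (exists D : submodClosed (A * B)%type,
     [/\ functional D, forall x, (g x, f x) \in D & onto D]).
Proof.
split=> [[D [Dfun Dgf [tD|oD]]]|[[D [Dfun Dgf tD]]|[D [Dfun Dgf oD]]]].
- by left; exists D.
- by right; exists D.
- by exists D; split=> //; left.
- by exists D; split=> //; right.
Qed.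

(** Pulling D back along u and v; used to pass between U and the two axes. *)
Lemma graph_extends_comp (R : pzRingType) (X A B A' B' : lmodType R)
    (f : {linear X -> B}) (g : {linear X -> A})
    (u : {linear A -> A'}) (v : {linear B -> B'}) :
    (forall a', exists a, u a = a') -> (forall b', exists b, v b = b') ->
    injective v ->
  graph_extends (v \o f) (u \o g) -> graph_extends f g.
Proof.
move=> u_surj v_surj v_inj [D [Dfun Dgf Dtotal_onto]].
pose E : submodClosed (A * B)%type :=
  preim_submod (pair_lin (u \o fst) (v \o snd)) D.
have memE a b : ((a, b) \in E) = ((u a, v b) \in D) by [].
exists E; split=> [b|//|].
  by rewrite memE linear0 => /Dfun vb; apply: v_inj; rewrite vb linear0.
case: Dtotal_onto => [tD|oD]; [left=> a | right=> b].
  have [b' Dab] := tD (u a); have [b bE] := v_surj b'.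
  by exists b; rewrite memE bE.
have [a' Dab] := oD (v b); have [a aE] := u_surj a'.
by exists a; rewrite memE aE.
Qed.

(** * Working forms of uniformity and hollowness *)

Section UniformHollow.

Variables (R : pzRingType) (U : lmodType R).

(** N is essential in a direct summand, which indecomposability forces to be 0 or U. *)
Lemma uniform_cap (N L : submodClosed U) : uniform U -> cap_trivial L N ->
  (forall x, x \in N -> x = 0) \/ (forall x, x \in L -> x = 0).
Proof.
move=> [[_ indecU] extU] LN; have [X [dsX [NX essN]]] := extU N.
have [X0|Xfull] := indecU X dsX; [left=> x /NX/X0 // | right].
by apply: essN => // x _; exact: Xfull.
Qed.

(** Lifting gives a summand D inside N with N/D small. Either D = U, so N = U, or D = 0; then a
    proper L would have a proper image in U/D that complements the small N/D. *)
Lemma hollow_sum (N L : submodClosed U) : hollow U -> sum_full N L ->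
  (forall x, x \in N) \/ (forall x, x \in L).
Proof.
move=> [[_ indecU] liftU] NL; have [D [dsD DN smallN]] := liftU N.
have [D0|Dfull] := indecU D dsD; [right=> x | by left=> x; exact: DN].
apply/negPn/negP => Lx.
apply: (smallN (im_submod (quotmod_pi D) L)).
  exists (quotmod_pi D x); apply/negP => /mem_imP[y Ly /quotmod_piP/D0/eqP].
  by rewrite subr_eq0 => /eqP yx; rewrite -yx Ly in Lx.
move=> q; have [n [y [Nn Ly qE]]] := NL (repr q).
exists (quotmod_pi D n), (quotmod_pi D y); split; try exact: mem_im.
by rewrite -linearD -qE; exact/esym/quotmod_reprK.
Qed.

End UniformHollow.

(** In other words, the preimage of a nonzero T under r is essential in W: r(L) meets T trivially,
    hence r(L) = 0, and then L lies in that preimage. *)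
Lemma uniform_pullback (R : pzRingType) (U W : lmodType R)
    (r : {linear W -> U}) (L : submodClosed W) (T : submodClosed U) :
    uniform U -> (exists2 t, t \in T & t <> 0) ->
    (forall l, l \in L -> r l \in T -> l = 0) ->
  forall l, l \in L -> l = 0.
Proof.
move=> uU [t Tt t0] LT0.
have LT : cap_trivial (im_submod r L) T.
  by move=> x /mem_imP[l Ll <-] Trl; rewrite (LT0 l Ll Trl) linear0.
case: (uniform_cap uU LT) => [/(_ t Tt)/t0 //|rL0] l Ll.
by apply: LT0 => //; rewrite (rL0 (r l)) ?rpred0 ?mem_im.
Qed.

Lemma cap_trivial_or_meets (R : pzRingType) (M : lmodType R) (N L : submodClosed M) :
  cap_trivial N L \/ exists v, [/\ v \in N, v \in L & v <> 0].
Proof.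
have [NL|NL] := pselect (exists v : M, [/\ v \in N, v \in L & v <> 0]).
  by right.
by left=> v Nv Lv; apply: contrapT => v0; apply: NL; exists v.
Qed.

(** * Graphs, complements and essential submodules in U x U *)

Section Biproduct.

(** V is U x U seen through two projections, so that each lemma also applies with the axes
    exchanged. *)
Variables (R : pzRingType) (U V : lmodType R) (p q : {linear V -> U}).
Hypothesis uU : uniform U.
Hypothesis hU : hollow U.
Hypothesis pq_inj : forall v, p v = 0 -> q v = 0 -> v = 0.
Hypothesis pq_surj : forall x y, exists v, p v = x /\ q v = y.

(** A contains a product P x Q of nonzero submodules of the axes; it is essential by
    [uniform_pullback] along p, then along q. *)
Lemma cap_axes_essential (A L : submodClosed V) :
    (exists v, [/\ v \in A, v \in ker_submod p & v <> 0]) ->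
    (exists v, [/\ v \in A, v \in ker_submod q & v <> 0]) ->
  cap_trivial L A -> forall v, v \in L -> v = 0.
Proof.
move=> [b [Ab /mem_kerP pb b0]] [a [Aa /mem_kerP qa a0]] LA.
pose P : submodClosed U := im_submod p (meet_submod A (ker_submod q)).
pose Q : submodClosed U := im_submod q (meet_submod A (ker_submod p)).
have P0 : exists2 x, x \in P & x <> 0.
  exists (p a); last by move=> pa; apply/a0/pq_inj.
  by apply: mem_im; rewrite mem_meet Aa; apply/mem_kerP.
have Q0 : exists2 x, x \in Q & x <> 0.
  exists (q b); last by move=> qb; apply/b0/pq_inj.
  by apply: mem_im; rewrite mem_meet Ab; apply/mem_kerP.
apply: (@uniform_pullback _ _ _ p _ P) => // v Lv Pv.
pose L1 : submodClosed V := meet_submod L (preim_submod p P).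
apply: (@uniform_pullback _ _ _ q L1 Q) => [//|//||]; last first.
  by rewrite mem_meet Lv mem_preim.
move=> w /andP[Lw /mem_imP[x /andP[Ax /mem_kerP qx] px]].
move=> /mem_imP[y /andP[Ay /mem_kerP py] qy].
suff wE : w = x + y by apply: LA; rewrite // wE rpredD.
apply/eqP; rewrite -subr_eq0; apply/eqP/pq_inj.
  by rewrite linearB linearD px py addr0 subrr.
by rewrite linearB linearD qx qy add0r subrr.
Qed.

(** If both projections of D were proper, hollowness would make D' the graph of a map U -> U with
    kernel all of U, yet sending p(D) onto U. *)
Lemma complement_of_graph (D D' : submodClosed V) :
    sum_full D D' -> cap_trivial D' (ker_submod p) ->
  (forall x, x \in im_submod p D) \/ (forall y, y \in im_submod q D).
Proof.
move=> DD' kerD'; apply: contrapT => /not_orP[pD qD].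
pose S : submodClosed U :=
  im_submod q (meet_submod D' (preim_submod p (im_submod p D))).
have [//|S_full] : (forall y, y \in im_submod q D) \/ (forall y, y \in S).
  (* Since p v = 0, the components d and d' of v have opposite first projections, which puts q d' in
     S. *)
  apply: hollow_sum => // y; have [v [pv <-]] := pq_surj 0 y.
  have [d [d' [Dd D'd' vE]]] := DD' v; exists (q d), (q d').
  rewrite vE linearD; split=> //; first exact: mem_im.
  apply: mem_im; rewrite mem_meet D'd' mem_preim; apply/mem_imP.
  exists (- d); first by rewrite -scaleN1r rpredZ.
  apply/eqP; rewrite linearN eq_sym -subr_eq0 opprK addrC -linearD -vE.
  exact/eqP.
have [//|pD'] : (forall x, x \in im_submod p D) \/ (forall x, x \in im_submod p D').
  apply: hollow_sum => // x; have [v [<- _]] := pq_surj x 0.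
  have [d [d' [Dd D'd' ->]]] := DD' v; exists (p d), (p d').
  by rewrite linearD; split=> //; exact: mem_im.
(* K is the kernel of the map with graph D'. *)
pose K : submodClosed U := im_submod p (meet_submod D' (ker_submod q)).
have [//|K_full] : (forall x, x \in im_submod p D) \/ (forall x, x \in K).
  apply: hollow_sum => // x; have /mem_imP[w D'w <-] := pD' x.
  have /mem_imP[u /andP[D'u pu] qu] := S_full (q w).
  exists (p u), (p (w - u)); split=> //; last by rewrite linearB addrC subrK.
  apply: mem_im; rewrite mem_meet submodB //; apply/mem_kerP.
  by rewrite linearB qu subrr.
have [[[u u0] _] _] := uU.
have /mem_imP[v /andP[D'v _] qv] := S_full u.
have /mem_imP[w /andP[D'w /mem_kerP qw] pw] := K_full (p v).
by rewrite -qv -(inj_on_linear kerD' D'w D'v pw) qw eqxx in u0.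
Qed.

(** T is the graph of a map h on a submodule N. The complement is [ker_submod p] when N = U,
    [ker_submod q] when h is bijective onto U, and the diagonal otherwise. *)
Lemma graph_summand (T : submodClosed (U * U)%type) :
  functional T -> total T \/ onto T ->
  direct_summand (preim_submod (pair_lin p q) T).
Proof.
move=> Tfun Ttotal_onto.
set D : submodClosed V := preim_submod (pair_lin p q) T.
have memD v : (v \in D) = ((p v, q v) \in T) by [].
have total_summand : total T -> direct_summand D.
  move=> Ttot; exists (ker_submod p : submodClosed V); split=> [v|v].
    by rewrite memD => Tv /mem_kerP pv; rewrite pv in Tv; apply/pq_inj/Tfun.
  have [b Tb] := Ttot (p v); have [w [pw qw]] := pq_surj (p v) b.
  exists w, (v - w); split; first by rewrite memD pw qw.
    by apply/mem_kerP; rewrite linearB pw subrr.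
  by rewrite addrC subrK.
case: Ttotal_onto => [//|Tonto].
pose N : submodClosed U := im_submod fst T.
pose K : submodClosed U := preim_submod (pair_lin idfun \0) T.
have [K0|K_non0] := pselect (forall a, a \in K -> a = 0).
  exists (ker_submod q : submodClosed V); split=> [v|v].
    rewrite memD => Tv /mem_kerP qv; rewrite qv in Tv.
    by apply: pq_inj => //; apply: K0.
  have [a Ta] := Tonto (q v); have [w [pw qw]] := pq_surj a (q v).
  exists w, (v - w); split; first by rewrite memD pw qw.
    by apply/mem_kerP; rewrite linearB qw subrr.
  by rewrite addrC subrK.
have [N_full|N_proper] := pselect (forall x, x \in N).
  by apply: total_summand => a; have /mem_imP[[a' b] Tab /= <-] := N_full a; exists b.
(* T is the graph of a map h : N -> U; as N is proper and h is onto with a     *)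
(* nonzero kernel, h minus the inclusion is an isomorphism N -> U, so the      *)
(* diagonal is a complement of T.                                              *)
pose Z : submodClosed U := preim_submod (pair_lin idfun idfun) T.
pose Y : submodClosed U := im_submod (snd \- fst) T.
(* Z consists of the fixed points of h, so it meets the kernel K trivially; K is nonzero, hence Z =
   0. *)
have Z0 z : z \in Z -> z = 0.
  have ZK : cap_trivial Z K.
    move=> x; rewrite !mem_preim /pair_lin /= => Txx Tx0.
    exact: functional_eq Tfun Txx Tx0.
  by case: (uniform_cap uU ZK) => [/K_non0|/(_ z)].
(* Writing y = h x, the sum y = (h x - x) + x shows Y + N = U. *)
have [Y_full|//] : (forall y, y \in Y) \/ (forall y, y \in N).
  apply: hollow_sum => // y; have [x Txy] := Tonto y.
  exists (y - x), x; split; last by rewrite subrK.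
    by apply/mem_imP; exists (x, y).
  by apply/mem_imP; exists (x, y).
exists (ker_submod (q \- p) : submodClosed V); split=> [v|v].
  rewrite memD => Tv /mem_kerP /= /eqP; rewrite subr_eq0 => /eqP qv.
  rewrite qv in Tv; have pv := Z0 _ Tv.
  by apply: pq_inj; rewrite ?qv.
have /mem_imP[[x y] Txy /= yx] := Y_full (q v - p v).
have [w [pw qw]] := pq_surj x y.
exists w, (v - w); split; first by rewrite memD pw qw.
  by apply/mem_kerP; rewrite linearB /= pw qw yx subrr.
by rewrite addrC subrK.
Qed.

(** p embeds the graph D in U, where the nonzero p(A) is essential. *)
Lemma graph_closure (A : submodClosed V) (T : submodClosed (U * U)%type) :
    (exists2 a, a \in A & a <> 0) -> functional T -> total T \/ onto T ->
    (forall a, a \in A -> (p a, q a) \in T) ->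
  exists D, direct_summand D /\ essential_in A D.
Proof.
move=> [a Aa a0] Tfun Ttotal_onto AT.
pose D : submodClosed V := preim_submod (pair_lin p q) T.
have kerD : cap_trivial D (ker_submod p).
  move=> v Dv /mem_kerP pv; have Tv : (p v, q v) \in T := Dv.
  by rewrite pv in Tv; apply/pq_inj/Tfun.
exists D; split; first exact: graph_summand.
split=> [v /AT //|L LD LA].
apply: (@uniform_pullback _ _ _ p _ (im_submod p A)) => //.
  exists (p a); first exact: mem_im.
  by move=> pa; apply/a0/kerD; [exact: AT | exact/mem_kerP].
move=> l Ll /mem_imP[b Ab pb]; apply: LA => //.
by rewrite -(inj_on_linear kerD (AT b Ab) (LD l Ll) pb).
Qed.

End Biproduct.

(** * Extending squares and extension of graphs *)

Section Square.

Variables (R : pzRingType) (U : lmodType R).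
Hypothesis uU : uniform U.
Hypothesis hU : hollow U.

Definition graph_extension : Prop :=
  forall (X : lmodType R) (f g : {linear X -> U}), injective g ->
  graph_extends f g.

Lemma fst_snd_inj (v : U * U) : fst v = 0 -> snd v = 0 -> v = 0.
Proof. by case: v => x y /= -> ->. Qed.

Lemma fst_snd_surj (x y : U) : exists v, fst v = x /\ snd v = y.
Proof. by exists (x, y). Qed.

Lemma snd_fst_inj (v : U * U) : snd v = 0 -> fst v = 0 -> v = 0.
Proof. by case: v => x y /= -> ->. Qed.

Lemma snd_fst_surj (x y : U) : exists v, snd v = x /\ fst v = y.
Proof. by exists (y, x). Qed.

Lemma extending_graph_extension :
  extending (U * U)%type -> graph_extension.
Proof.
move=> extV X f g g_inj.
have [D [[D' [capD sumD]] [GD essD]]] :=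
  extV (im_submod (pair_lin g f) (full_submod X)).
have Dgf x : (g x, f x) \in D by apply: GD; apply/mem_imP; exists x.
(* When D = 0 the graph of the zero map serves; otherwise D being nonzero supplies the final
   contradiction. *)
have [D0|D_non0] := pselect (forall v, v \in D -> v = 0).
  pose T : submodClosed (U * U)%type := ker_submod snd.
  exists T; split=> [b /mem_kerP //|x|].
    by rewrite (D0 _ (Dgf x)) rpred0.
  by left=> a; exists 0; apply/mem_kerP.
(* The graph of f over g misses this axis because g is injective; being essential in D, it makes D
   miss it too. *)
have kerD : cap_trivial D (ker_submod fst).
  move=> v Dv v1.
  apply: (essD (meet_submod D (ker_submod fst))); last by rewrite mem_meet Dv.
    by move=> w /andP[].
  move=> w /andP[_ /mem_kerP w1] /mem_imP[x _ wE].
  have x0 : x = 0 by apply: g_inj; rewrite linear0 -w1 -wE.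
  by rewrite -wE x0 linear0.
exists D; split=> // [b Db|].
  by have [] : (0, b) = 0 :> U * U by apply: kerD => //; apply/mem_kerP.
have tot : (forall x, x \in im_submod fst D) -> total D.
  by move=> D_full a; have /mem_imP[[x b] Dxb /= <-] := D_full a; exists b.
have ont : (forall y, y \in im_submod snd D) -> onto D.
  by move=> D_full b; have /mem_imP[[a y] Day /= <-] := D_full b; exists a.
have [k1|e1] := cap_trivial_or_meets D' (ker_submod fst).
  have [/tot|/ont] := complement_of_graph uU hU fst_snd_surj sumD k1.
    by left.
  by right.
(* The same argument with the axes exchanged, which swaps total and onto. *)
have [k2|e2] := cap_trivial_or_meets D' (ker_submod snd).
  have [/ont|/tot] := complement_of_graph uU hU snd_fst_surj sumD k2.
    by right.
  by left.
case: D_non0; exact: (cap_axes_essential uU fst_snd_inj e1 e2 capD).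
Qed.

Lemma graph_extension_extending :
  graph_extension -> extending (U * U)%type.
Proof.
move=> extG A.
have [A0|A_non0] := pselect (forall v, v \in A -> v = 0).
  exists A; split; last by split=> // L LA _ v /LA/A0.
  exists (full_submod _ : submodClosed (U * U)%type); split=> [v /A0 //|v].
  by exists 0, v; rewrite rpred0 add0r.
have {A_non0} A_non0 : exists2 a, a \in A & a <> 0.
  by move/existsNP: A_non0 => [a /not_implyP[]]; exists a.
have val_inj_on (r : {linear (U * U)%type -> U}) :
    cap_trivial A (ker_submod r) -> injective (r \o val : submod A -> U).
  move=> kerA x y; move/(inj_on_linear kerA (valP x) (valP y)).
  exact: val_inj.
(* Missing this axis makes [fst] injective on A, so A itself is the source X, with g and f the two
   projections. *)
have [k1|e1] := cap_trivial_or_meets A (ker_submod fst).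
  have [T [Tfun AT Ttotal_onto]] :=
    extG (submod A) (snd \o val) (fst \o val) (val_inj_on fst k1).
  apply: (graph_closure uU hU fst_snd_inj fst_snd_surj A_non0 Tfun) => // a Aa.
  exact: (AT (Submod Aa)).
have [k2|e2] := cap_trivial_or_meets A (ker_submod snd).
  have [T [Tfun AT Ttotal_onto]] :=
    extG (submod A) (fst \o val) (snd \o val) (val_inj_on snd k2).
  apply: (graph_closure uU hU snd_fst_inj snd_fst_surj A_non0 Tfun) => // a Aa.
  exact: (AT (Submod Aa)).
exists (full_submod _ : submodClosed (U * U)%type); split.
  exists (ker_submod idfun : submodClosed (U * U)%type); split=> [v _ /mem_kerP //|v].
  by exists v, 0; rewrite rpred0 addr0.
by split=> // L _; exact: (cap_axes_essential uU fst_snd_inj e1 e2).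
Qed.

End Square.

(** * Identification of U with the two axes *)

Section Axes.

Variables (R : pzRingType) (U : lmodType R).

Definition to_axis1 (x : U) : submod (axis1 U) :=
  @Submod _ _ (axis1 U) (x, 0) (eqxx 0).

Definition to_axis2 (x : U) : submod (axis2 U) :=
  @Submod _ _ (axis2 U) (0, x) (eqxx 0).

Fact to_axis1_linear : linear to_axis1.
Proof.
by move=> a x y; apply: val_inj; congr pair; rewrite /= scaler0 addr0.
Qed.

Fact to_axis2_linear : linear to_axis2.
Proof.
by move=> a x y; apply: val_inj; congr pair; rewrite /= scaler0 addr0.
Qed.

HB.instance Definition _ :=
  GRing.isLinear.Build R U (submod (axis1 U)) *:%R to_axis1 to_axis1_linear.
HB.instance Definition _ :=
  GRing.isLinear.Build R U (submod (axis2 U)) *:%R to_axis2 to_axis2_linear.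

Lemma to_axis1K : cancel to_axis1 (fst \o val). Proof. by []. Qed.

Lemma to_axis2K : cancel to_axis2 (snd \o val). Proof. by []. Qed.

Lemma of_axis1K : cancel (fst \o val) to_axis1.
Proof. by case=> [[x y] y0]; apply: val_inj; congr pair; apply/esym/eqP. Qed.

Lemma of_axis2K : cancel (snd \o val) to_axis2.
Proof. by case=> [[x y] x0]; apply: val_inj; congr pair; apply/esym/eqP. Qed.

Lemma graph_extension_axes :
  graph_extension U <->
  forall (X : lmodType R)
    (f : {linear X -> submod (axis2 U)}) (g : {linear X -> submod (axis1 U)}),
    injective g -> graph_extends f g.
Proof.
split=> extG X f g g_inj.
  apply: (@graph_extends_comp _ _ _ _ _ _ _ _ (fst \o val) (snd \o val)).
  - by move=> a; exists (to_axis1 a); exact: to_axis1K.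
  - by move=> b; exists (to_axis2 b); exact: to_axis2K.
  - exact: can_inj of_axis2K.
  - by apply: extG; apply: inj_comp g_inj; exact: can_inj of_axis1K.
apply: (@graph_extends_comp _ _ _ _ _ _ _ _ to_axis1 to_axis2).
- by move=> a; exists ((fst \o val) a); exact: of_axis1K.
- by move=> b; exists ((snd \o val) b); exact: of_axis2K.
- exact: can_inj to_axis2K.
- by apply: extG; apply: inj_comp g_inj; exact: can_inj to_axis1K.
Qed.

End Axes.

Theorem theorem2p4 (R : pzRingType) (U : lmodType R^c)
    (U_uniform : uniform U) (U_hollow : hollow U) :
  let U1 : submodClosed (U * U)%type := axis1 U in
  let U2 : submodClosed (U * U)%type := axis2 U in
  let condA : Prop := extending (U * U)%type in
  let condB : Prop :=
    forall (X : lmodType R^c)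
      (f : {linear X -> submod U2}) (g : {linear X -> submod U1}),
      injective g ->
      (exists h : {linear submod U1 -> submod U2}, forall x, f x = h (g x)) \/
      (exists (K : submodClosed (submod U1))
              (h : {linear submod U2 -> quotmod K}),
          injective h /\ forall x, h (f x) = quotmod_pi K (g x)) in
  let condC : Prop :=
    forall (X : lmodType R^c)
      (f : {linear X -> submod U2}) (g : {linear X -> submod U1}),
      injective g ->
      (exists h : {linear submod U1 -> submod U2}, forall x, f x = h (g x)) \/
      (exists (N : submodClosed (submod U1))
              (img : forall x, g x \in N)
              (h : {linear submod N -> submod U2}),
          (forall y, exists n, h n = y) /\
          forall x, f x = h (Submod (img x))) in
  (condA <-> condB) /\ (condB <-> condC).
Proof.
have condAE : extending (U * U)%type <-> graph_extension U.
  split; first exact: extending_graph_extension.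
  exact: graph_extension_extending.
move=> U1 U2 condA condB condC.
have condBE : condB <-> graph_extension U.
  rewrite graph_extension_axes; split=> ext X f g g_inj.
    apply/graph_extendsE; rewrite -total_extensionP -quotient_extensionP.
    exact: ext.
  by rewrite total_extensionP quotient_extensionP -graph_extendsE; apply: ext.
have condCE : condC <-> graph_extension U.
  rewrite graph_extension_axes; split=> ext X f g g_inj.
    apply/graph_extendsE; rewrite -total_extensionP -partial_extensionP.
    exact: ext.
  by rewrite total_extensionP partial_extensionP -graph_extendsE; apply: ext.
by split; [rewrite condBE | rewrite condBE condCE].
Qed.
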